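(* For every $n\ge 3$ and $0\le k\le n$, $s_n^k(231,312,321)=\binom{\frac{n+k}{2}}{k}$ if $n+k$ is even, and $s_n^k(231,312,321)=0$ if $n+k$ is odd.
   Context: $S_n$ denotes the set of permutations of $\{1,\dots,n\}$ written in one-line notation $\pi=\pi_1\pi_2\cdots\pi_n$. For $\alpha\in S_m$, $\pi\in S_n$ contains the pattern $\alpha$ if there are indices $i_1<i_2<\dots<i_m$ such that $\pi_{i_1}\pi_{i_2}\cdots\pi_{i_m}$ is order-isomorphic to $\alpha$; otherwise $\pi$ avoids $\alpha$. For a set $T$ of patterns, $S_n^k(T)$ is the set of $\pi\in S_n$ that have exactly $k$ fixed points (indices $i$ with $\pi_i=i$) and avoid every pattern in $T$; $s_n^k(T)=|S_n^k(T)|$. The braces around $T$ are omitted, e.g. $s_n^k(231,312,321)=s_n^k(\{231,312,321\})$. *)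

(* Defs.v *)
From HB Require Import structures.
From mathcomp Require Import all_boot all_fingroup.

Set Implicit Arguments.
Unset Strict Implicit.
Unset Printing Implicit Defensive.

(* A permutation of {1, ..., n} is an element of 'S_n, with positions and     *)
(* values both shifted to {0, ..., n-1}: this changes neither the relative    *)
(* order of the entries nor the fixed points.                                 *)
(* A pattern in S_m is given by its one-line notation, a sequence of length   *)
(* m; for instance 231 is [:: 2; 3; 1].                                       *)

Definition contains (n : nat) (alpha : seq nat) (p : 'S_n) : bool :=
  [exists i : {ffun 'I_(size alpha) -> 'I_n},
    [forall a : 'I_(size alpha), forall b : 'I_(size alpha),
      (a < b) ==> (i a < i b)] &&
    [forall a : 'I_(size alpha), forall b : 'I_(size alpha),
      (p (i a) < p (i b)) == (nth 0 alpha a < nth 0 alpha b)]].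

Definition avoids (n : nat) (alpha : seq nat) (p : 'S_n) : bool :=
  ~~ contains alpha p.

Definition fixed_points (n : nat) (p : 'S_n) : {set 'I_n} :=
  [set i | p i == i].

Definition avoiders (n k : nat) (T : seq (seq nat)) : {set 'S_n} :=
  [set p : 'S_n | (#|fixed_points p| == k)
                  && all (fun alpha => avoids alpha p) T].

Definition num_avoiders (n k : nat) (T : seq (seq nat)) : nat :=
  #|avoiders n k T|.

(* Main.v *)
Require Import Defs.
From HB Require Import structures.
From mathcomp Require Import all_boot all_fingroup.
From mathcomp Require Import zify.

Set Implicit Arguments.
Unset Strict Implicit.
Unset Printing Implicit Defensive.

(** The patterns 231, 312 and 321 are exactly the three patterns of length 3
    whose first entry exceeds their last one.  Hence a permutation avoids all
    three iff no two entries at distance at least 2 form an inversion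
    ([avoids_adjacent_inversions]).

    In such a permutation the value 0 stands in position 0 or 1, and in the
    latter case the value 1 stands in position 0: the permutation is a direct
    sum of blocks 1 and 21 ([adjacent_inversions_head]).  Removing the first
    block gives a recurrence: the permutations of size n + 2 with k fixed points
    split into those of size n + 1 with k - 1 fixed points, preceded by a block
    1, and those of size n with k fixed points, preceded by a block 21
    ([card_restricted_rec]).  With m = (n + k + 2) / 2 the number of blocks,
    this is Pascal's rule C(m, k) = C(m - 1, k - 1) + C(m - 1, k), and the
    closed form follows by induction. *)

(** * Avoidance as a condition on inversions *)

Definition adjacent_inversions n (p : 'S_n) : bool :=
  [forall i : 'I_n, forall j : 'I_n, (i.+1 < j) ==> (p i < p j)].

Lemma adjacent_inversionsP n (p : 'S_n) :
  reflect (forall i j : 'I_n, i.+1 < j -> p i < p j) (adjacent_inversions p).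
Proof.
apply: (iffP idP) => [/forallP H i j|H].
  by move/forallP: (H i) => /(_ j)/implyP.
by apply/forallP => i; apply/forallP => j; apply/implyP; apply: H.
Qed.

Lemma contains3P n (p : 'S_n) a b c :
  reflect (exists x y z : 'I_n, [/\ x < y, y < z &
             [/\ (p x < p y) = (a < b), (p y < p x) = (b < a),
                 (p x < p z) = (a < c), (p z < p x) = (c < a) &
                 (p y < p z) = (b < c) /\ (p z < p y) = (c < b)]])
          (contains [:: a; b; c] p).
Proof.
apply: (iffP existsP) => [[f /andP [/forallP H1 /forallP H2]]|].
  pose o0 : 'I_3 := ord0.
  pose o1 : 'I_3 := inord 1.
  pose o2 : 'I_3 := inord 2.
  have e1 : (o1 : nat) = 1 by rewrite inordK.
  have e2 : (o2 : nat) = 2 by rewrite inordK.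
  have L (u v : 'I_3) : u < v -> f u < f v.
    by move=> h; move/forallP: (H1 u) => /(_ v); rewrite h.
  have V (u v : 'I_3) : (p (f u) < p (f v)) = (nth 0 [:: a; b; c] u < nth 0 [:: a; b; c] v).
    by move/forallP: (H2 u) => /(_ v) /eqP.
  exists (f o0), (f o1), (f o2); split; first by apply: L; rewrite e1.
    by apply: L; rewrite e1 e2.
  by split; [| | | |split]; rewrite V ?e1 ?e2.
move=> [x [y [z [xy yz [h1 h2 h3 h4 [h5 h6]]]]]].
exists [ffun u : 'I_3 => nth x [:: x; y; z] u].
apply/andP; split; apply/forallP => u; apply/forallP => v; rewrite !ffunE.
  apply/implyP; case: u v => [[|[|[|u]]] hu] [[|[|[|v]]] hv] //= _.
  exact: ltn_trans yz.
by case: u v => [[|[|[|u]]] hu] [[|[|[|v]]] hv] //=; rewrite ?ltnn ?h1 ?h2 ?h3 ?h4 ?h5 ?h6.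
Qed.

(** If i and j with i + 1 < j form an inversion, the entry in position i + 1
    completes it to 231, 312 or 321 according to its value being above, below
    or between the other two; conversely each pattern inverts its two ends. *)
Lemma avoids_adjacent_inversions n (p : 'S_n) :
  all (fun alpha => avoids alpha p)
      [:: [:: 2; 3; 1]; [:: 3; 1; 2]; [:: 3; 2; 1]] = adjacent_inversions p.
Proof.
apply/idP/adjacent_inversionsP => [/and4P [A1 A2 A3 _] i j ij|H].
  have im : i.+1 < n by apply: leq_trans (ltn_ord j); apply: ltnW.
  pose m : 'I_n := Ordinal im.
  have neq (u v : 'I_n) : u < v -> (p u : nat) != p v.
    by move=> uv; apply/eqP => /val_inj/perm_inj e; rewrite e ltnn in uv.
  have ne1 : (p i : nat) != p m by apply: neq => /=.
  have ne2 : (p m : nat) != p j by apply: neq.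
  have ne3 : (p i : nat) != p j by apply: neq; apply: ltnW.
  rewrite ltnNge; apply/negP => ji.
  case: (ltnP (p i) (p m)) => [c1|c1].
    by case/contains3P: A1; exists i, m, j; do !split => //=; lia.
  case: (ltnP (p m) (p j)) => [c2|c2].
    by case/contains3P: A2; exists i, m, j; do !split => //=; lia.
  by case/contains3P: A3; exists i, m, j; do !split => //=; lia.
have K (x y z : 'I_n) : x < y -> y < z -> (p z < p x) = false.
  by move=> xy yz; apply/negbTE; rewrite -leqNgt ltnW // H // (leq_ltn_trans xy).
by rewrite /= /avoids; apply/and4P; split => //;
   apply/contains3P => -[x [y [z [xy yz [_ _ _ + _]]]]]; rewrite (K x y z).
Qed.

(** * Direct sums with a first block 1 or 21 *)

Lemma lift_perm_inj n (i j : 'I_n.+1) : injective (lift_perm i j).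
Proof.
move=> q r e; apply/permP => x; apply: (@lift_inj _ j).
by rewrite -!(lift_perm_lift i) e.
Qed.

Lemma lift_perm_onto n (i j : 'I_n.+1) (p : 'S_n.+1) :
  p i = j -> exists q, p = lift_perm i j q.
Proof.
move=> pij.
have neq k : j != p (lift i k).
  by rewrite -pij (inj_eq perm_inj) neq_lift.
pose f k := odflt k (unlift j (p (lift i k))).
have fE k : lift j (f k) = p (lift i k).
  by rewrite /f; case: (unlift_some (neq k)) => u -> ->.
have f_inj : injective f.
  by move=> u v e; apply/(@lift_inj _ i)/(@perm_inj _ p); rewrite -!fE e.
exists (perm f_inj); apply/permP => k.
case: (unliftP i k) => [u ->|->]; first by rewrite lift_perm_lift permE fE.
by rewrite lift_perm_id.
Qed.

Definition block1 n (q : 'S_n) : 'S_n.+1 := lift_perm ord0 ord0 q.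

(** The outer lift sends 0 to 1; the inner one sends 1 to the least remaining
    value, which is 0. *)
Definition block21 n (q : 'S_n) : 'S_n.+2 :=
  lift_perm ord0 (lift ord0 ord0) (block1 q).

Lemma block1_0 n (q : 'S_n) : block1 q ord0 = ord0.
Proof. exact: lift_perm_id. Qed.

Lemma block1_S n (q : 'S_n) i : block1 q (lift ord0 i) = lift ord0 (q i).
Proof. exact: lift_perm_lift. Qed.

Lemma block21_0 n (q : 'S_n) : block21 q ord0 = lift ord0 ord0.
Proof. exact: lift_perm_id. Qed.

Lemma block21_1 n (q : 'S_n) : block21 q (lift ord0 ord0) = ord0.
Proof. by rewrite lift_perm_lift block1_0; apply: val_inj. Qed.

Lemma block21_SS n (q : 'S_n) i :
  block21 q (lift ord0 (lift ord0 i)) = lift ord0 (lift ord0 (q i)).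
Proof. by rewrite lift_perm_lift block1_S; apply: val_inj. Qed.

Lemma block21_inj n : injective (@block21 n).
Proof. by move=> q r /lift_perm_inj/lift_perm_inj. Qed.

Lemma block21_onto n (p : 'S_n.+2) :
  p ord0 = lift ord0 ord0 -> p (lift ord0 ord0) = ord0 ->
  exists q, p = block21 q.
Proof.
move=> p0 p1; have [r er] := lift_perm_onto p0.
have r0 : r ord0 = ord0.
  apply: (@lift_inj _ (lift ord0 ord0)).
  by rewrite -(lift_perm_lift ord0) -er p1; apply: val_inj.
by have [q eq] := lift_perm_onto r0; exists q; rewrite er eq.
Qed.

Lemma fixed_points_sum n (p : 'S_n) : #|fixed_points p| = \sum_(i < n) (p i == i).
Proof. by rewrite cardsE -sum1_card big_mkcond. Qed.

Lemma fixed_points_block1 n (q : 'S_n) :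
  #|fixed_points (block1 q)| = #|fixed_points q|.+1.
Proof.
rewrite !fixed_points_sum big_ord_recl block1_0 eqxx; congr _.+1.
by apply: eq_bigr => i _; rewrite block1_S (inj_eq lift_inj).
Qed.

Lemma fixed_points_block21 n (q : 'S_n) :
  #|fixed_points (block21 q)| = #|fixed_points q|.
Proof.
rewrite !fixed_points_sum !big_ord_recl block21_0 block21_1 !add0n.
by apply: eq_bigr => i _; rewrite block21_SS !(inj_eq lift_inj).
Qed.

Lemma adjacent_inversions_block1 n (q : 'S_n) :
  adjacent_inversions (block1 q) = adjacent_inversions q.
Proof.
apply/adjacent_inversionsP/adjacent_inversionsP => H i j.
  by move=> ij; have := H (lift ord0 i) (lift ord0 j); rewrite !block1_S; apply.
case: (unliftP ord0 j) => [v ->|->] //.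
case: (unliftP ord0 i) => [u ->|->]; rewrite ?block1_0 !block1_S //.
exact: H.
Qed.

Lemma adjacent_inversions_block21 n (q : 'S_n) :
  adjacent_inversions (block21 q) = adjacent_inversions q.
Proof.
apply/adjacent_inversionsP/adjacent_inversionsP => H i j.
  move=> ij; have := H (lift ord0 (lift ord0 i)) (lift ord0 (lift ord0 j)).
  by rewrite !block21_SS; apply.
case: (unliftP ord0 j) => [v ->|->] //.
case: (unliftP ord0 v) => [{}v ->|->] //.
rewrite block21_SS; case: (unliftP ord0 i) => [u ->|->]; last by rewrite block21_0.
case: (unliftP ord0 u) => [{}u ->|->]; last by rewrite block21_1.
rewrite block21_SS; exact: H.
Qed.

(** An entry in position at least 2 exceeds the one in position 0, so the
    value 0 stands in position 0 or 1.  If it stands in position 1, then the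
    value 1 cannot lie in position 2 or later: it would exceed the entry in
    position 0, which is not the value 0. *)
Lemma adjacent_inversions_head n (p : 'S_n.+2) :
  adjacent_inversions p ->
  p ord0 = ord0 \/ p ord0 = lift ord0 ord0 /\ p (lift ord0 ord0) = ord0.
Proof.
move/adjacent_inversionsP => H.
have [x px] : exists x, p x = ord0 by exists ((p^-1)%g ord0); rewrite permKV.
have [y py] : exists y, p y = lift ord0 ord0.
  by exists ((p^-1)%g (lift ord0 ord0)); rewrite permKV.
case: (unliftP ord0 x) px => [u ->|-> ->]; last by left.
case: (unliftP ord0 u) => [{}u -> px|-> p1].
  by have := H ord0 (lift ord0 (lift ord0 u)) isT; rewrite px.
right; split=> //; case: (unliftP ord0 y) py => [v ->|-> //].
case: (unliftP ord0 v) => [{}v ->|->] py; last by rewrite p1 in py.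
have := H ord0 (lift ord0 (lift ord0 v)) isT; rewrite py ltnS leqn0 => /eqP e.
by have /perm_inj : p ord0 = p (lift ord0 ord0) by rewrite p1; apply: val_inj.
Qed.

(** * The count *)

Definition restricted n k : {set 'S_n} :=
  [set p : 'S_n | (#|fixed_points p| == k) && adjacent_inversions p].

Lemma num_avoiders_restricted n k :
  num_avoiders n k [:: [:: 2; 3; 1]; [:: 3; 1; 2]; [:: 3; 2; 1]]
    = #|restricted n k|.
Proof.
by congr #|pred_of_set _|; apply/setP => p; rewrite !inE avoids_adjacent_inversions.
Qed.

Lemma card_restricted_small n k : n <= 1 -> #|restricted n k| = (k == n).
Proof.
move=> n1.
have n_eq (i j : 'I_n) : i = j.
  by apply: val_inj => /=; have := ltn_ord i; have := ltn_ord j; lia.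
have E (p : 'S_n) : (p \in restricted n k) = (k == n).
  rewrite inE fixed_points_sum (eq_bigr (fun=> 1)); last first.
    by move=> i _; rewrite (n_eq (p i) i) eqxx.
  rewrite sum1_card card_ord eq_sym andb_idr // => _.
  by apply/adjacent_inversionsP => i j; rewrite (n_eq i j) ltnNge leqnSn.
rewrite (eq_card (B := fun _ => k == n)) //; case: (k == n).
  rewrite (eq_card (B := 'S_n)) // card_Sn.
  by case: n n1 {n_eq E} => [|[]].
by rewrite eq_card0.
Qed.

Lemma card_restricted_rec n k :
  #|restricted n.+2 k| =
    (if k is k'.+1 then #|restricted n.+1 k'| else 0) + #|restricted n k|.
Proof.
rewrite -(cardsID [set p : 'S_n.+2 | p ord0 == ord0]); congr (_ + _).
  case: k => [|k].
    apply: eq_card0 => p; rewrite !inE; apply/negP => /andP [/andP [+ _] /eqP p0].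
    by have [q ->] := lift_perm_onto p0; rewrite fixed_points_block1.
  rewrite /= -(card_imset (restricted n.+1 k) (@lift_perm_inj _ ord0 ord0)); apply: eq_card => p.
  rewrite !inE; apply/andP/imsetP => [[Hp /eqP p0]|[q Hq ->]].
    have [q eq] := lift_perm_onto p0; exists q => //.
    by move: Hp; rewrite eq inE fixed_points_block1 adjacent_inversions_block1.
  rewrite fixed_points_block1 adjacent_inversions_block1 lift_perm_id.
  by move: Hq; rewrite inE.
rewrite -(card_imset (restricted n k) (@block21_inj n)); apply: eq_card => p.
rewrite !inE; apply/andP/imsetP => [[p0 Hp]|[q Hq ->]]; last first.
  rewrite block21_0 fixed_points_block21 adjacent_inversions_block21.
  by move: Hq; rewrite inE.
have /andP [_ Ap] := Hp.
have [e|[e0 e1]] := adjacent_inversions_head Ap; first by rewrite e eqxx in p0.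
have [q eq] := block21_onto e0 e1; exists q => //.
by move: Hp; rewrite eq inE fixed_points_block21 adjacent_inversions_block21.
Qed.

Lemma card_restricted n k :
  #|restricted n k| = if odd (n + k) then 0 else 'C((n + k)./2, k).
Proof.
(* The recurrence goes back two sizes, so two consecutive ones are proved. *)
suff: (forall k, #|restricted n k| = if odd (n + k) then 0 else 'C((n + k)./2, k))
   /\ (forall k, #|restricted n.+1 k| =
         if odd (n.+1 + k) then 0 else 'C((n.+1 + k)./2, k)) by case.
elim: n {k} => [|n [IH0 IH1]].
  split=> -[|k]; rewrite card_restricted_small //.
    by rewrite bin_small ?if_same //=; lia.
  case: k => [|k] //; rewrite bin_small ?if_same //=; lia.
split=> // k; rewrite card_restricted_rec IH0; case: k => [|k].
  by rewrite !addn0 /= negbK bin0.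
rewrite IH1 !(addSn, addnS) /= !negbK.
by case: (odd (n + k)) => //=; rewrite binS addnC.
Qed.

Unset Implicit Arguments.

Theorem theorem3p9 (n k : nat) (hn : 3 <= n) (hk : k <= n) :
  (~~ odd (n + k) ->
     num_avoiders n k [:: [:: 2; 3; 1]; [:: 3; 1; 2]; [:: 3; 2; 1]]
       = 'C((n + k) %/ 2, k)) /\
  (odd (n + k) ->
     num_avoiders n k [:: [:: 2; 3; 1]; [:: 3; 1; 2]; [:: 3; 2; 1]] = 0).
Proof.
rewrite num_avoiders_restricted card_restricted divn2.
by split=> [/negbTE|] ->.
Qed.
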